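(* There exist a symmetric association scheme $\mathcal X = (X, \{R_i\}_{i=0}^d)$ and an ordering $\{E_i\}_{i=0}^d$ of its primitive idempotents (with $E_0 = |X|^{-1}J$) such that $\mathcal X$ is numerically self-dual with respect to the ordering $\{E_i\}_{i=0}^d$ but $\mathcal X$ is not formally self-dual with respect to the ordering $\{E_i\}_{i=0}^d$.
   Context: Let $d \ge 1$ be an integer. A ($d$-class) symmetric association scheme is a sequence $\mathcal X = (X, \{R_i\}_{i=0}^d)$ where $X$ is a finite nonempty set and $R_0,\ldots,R_d$ are nonempty subsets of $X\times X$ such that: (i) $X\times X$ is the disjoint union of $R_0,\ldots,R_d$; (ii) $R_0=\{(x,x): x\in X\}$; (iii) each $R_i$ is symmetric, i.e. $(x,y)\in R_i$ implies $(y,x)\in R_i$; (iv) there exist integers $p^h_{i,j}$ $(0\le h,i,j\le d)$, called the intersection numbers, such that for every $(x,y)\in R_h$, $p^h_{i,j}=|\{z\in X : (x,z)\in R_i,\ (z,y)\in R_j\}|$. The associate matrix $A_i\in \mathrm{Mat}_X(\mathbb C)$ has $(x,y)$-entry $1$ if $(x,y)\in R_i$ and $0$ otherwise. The matrices $\{A_i\}_{i=0}^d$ form a basis of a commutative algebra $\mathcal M$ (the Bose-Mesner algebra). $\mathcal M$ has a second basis $\{E_i\}_{i=0}^d$, the primitive idempotents, with $\sum_i E_i=I$, $E_iE_j=\delta_{i,j}E_i$, and $E_0=|X|^{-1}J$, where $J$ is the all ones matrix; an ordering of the primitive idempotents always has $E_0=|X|^{-1}J$. With respect to an ordering $\{E_i\}_{i=0}^d$,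 the first eigenmatrix $P$ and second eigenmatrix $Q$ in $\mathrm{Mat}_{d+1}(\mathbb C)$ (rows and columns indexed by $0,\ldots,d$) are defined by $A_j=\sum_{i=0}^d P_{i,j}E_i$ and $E_j=|X|^{-1}\sum_{i=0}^d Q_{i,j}A_i$ for $0\le j\le d$. The Krein parameters $q^h_{i,j}$ are defined by $E_i\circ E_j=|X|^{-1}\sum_{h=0}^d q^h_{i,j}E_h$ for $0\le i,j\le d$, where $\circ$ is the entry-wise product. $\mathcal X$ is formally self-dual with respect to the ordering $\{E_i\}_{i=0}^d$ if $P=Q$. $\mathcal X$ is numerically self-dual with respect to the ordering $\{E_i\}_{i=0}^d$ if $p^h_{i,j}=q^h_{i,j}$ for all $0\le h,i,j\le d$. *)

(* Defs.v *)
From HB Require Import structures.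
From mathcomp Require Import all_boot all_order all_algebra.
From mathcomp Require Import reals complex.
Set Implicit Arguments.
Unset Strict Implicit.
Unset Printing Implicit Defensive.
Import Order.TTheory GRing.Theory Num.Theory.
Local Open Scope ring_scope.

(* The intersection numbers are kept as data: they are determined by the
   relations, since every relation is nonempty. *)
Record sym_scheme (d : nat) (X : finType) := SymScheme {
  scheme_rel : 'I_d.+1 -> {set X * X};
  inter_num : 'I_d.+1 -> 'I_d.+1 -> 'I_d.+1 -> int;
  scheme_class_gt0 : (0 < d)%N;
  scheme_card_gt0 : (0 < #|X|)%N;
  scheme_rel_neq0 : forall i, scheme_rel i != set0;
  scheme_rel_cover : \bigcup_i scheme_rel i = [set: X * X];
  scheme_rel_disjoint : forall i j, i != j ->
    [disjoint scheme_rel i & scheme_rel j];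
  scheme_rel0 : scheme_rel ord0 = [set xy | xy.1 == xy.2];
  scheme_rel_sym : forall i x y,
    (x, y) \in scheme_rel i -> (y, x) \in scheme_rel i;
  inter_numP : forall h i j x y, (x, y) \in scheme_rel h ->
    inter_num h i j =
    #|[set z | ((x, z) \in scheme_rel i) && ((z, y) \in scheme_rel j)]|%:Z
}.

Section Definitions.
Variables (R : realType) (d : nat) (X : finType) (S : sym_scheme d X).
Local Notation MatX := 'M[R[i]]_#|X|.

(* Mat_X(C) is realized by matrices indexed by 'I_#|X|, identified with X
   through the enumeration of X. *)
Definition assoc_mx (i : 'I_d.+1) : MatX :=
  \matrix_(a, b) ((enum_val a, enum_val b) \in scheme_rel S i)%:R.

Definition assoc_tuple : d.+1.-tuple MatX := [tuple assoc_mx i | i < d.+1].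

Definition bose_mesner : {vspace MatX} := <<assoc_tuple>>%VS.

Definition hadamard_mx (A B : MatX) : MatX := map2_mx *%R A B.

Variable E : 'I_d.+1 -> MatX.

Definition idem_tuple : d.+1.-tuple MatX := [tuple E i | i < d.+1].

Record idempotent_ordering : Prop := IdempotentOrdering {
  idem_basis : basis_of bose_mesner idem_tuple;
  idem_sum : \sum_i E i = 1%:M;
  idem_mul : forall i j, E i *m E j = if i == j then E i else 0;
  idem0 : E ord0 = (#|X|%:R)^-1 *: const_mx 1
}.

(* [coord b i v] is the i-th coordinate of v in the basis b.  The defining
   equations of P, Q and the Krein parameters are [eigenmx1P], [eigenmx2P] and
   [krein_numP] below. *)
Definition eigenmx1 : 'M[R[i]]_d.+1 :=
  \matrix_(i, j) coord idem_tuple i (assoc_mx j).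

Definition eigenmx2 : 'M[R[i]]_d.+1 :=
  \matrix_(i, j) coord assoc_tuple i (#|X|%:R *: E j).

Definition krein_num (h i j : 'I_d.+1) : R[i] :=
  coord idem_tuple h (#|X|%:R *: hadamard_mx (E i) (E j)).

Definition formally_self_dual : Prop := eigenmx1 = eigenmx2.

Definition numerically_self_dual : Prop :=
  forall h i j, (inter_num S h i j)%:~R = krein_num h i j.

Let cardX_neq0 : #|X|%:R != 0 :> R[i].
Proof. by rewrite pnatr_eq0 -lt0n (scheme_card_gt0 S). Qed.

Let assoc_nth (i : 'I_d.+1) : assoc_tuple`_i = assoc_mx i.
Proof. by rewrite -tnth_nth tnth_mktuple. Qed.

Let idem_nth (i : 'I_d.+1) : idem_tuple`_i = E i.
Proof. by rewrite -tnth_nth tnth_mktuple. Qed.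

Lemma assoc_mx_hadamard i j :
  hadamard_mx (assoc_mx i) (assoc_mx j) = if i == j then assoc_mx i else 0.
Proof.
apply/matrixP=> a b; rewrite !mxE; case: eqVneq => [<-|neq_ij]; rewrite !mxE.
  by rewrite -natrM mulnb andbb.
case: (boolP (_ \in scheme_rel S i)) => [Ri|_]; last by rewrite mul0r.
by rewrite (disjointFr (scheme_rel_disjoint S neq_ij) Ri) mulr0.
Qed.

Lemma assoc_free : free assoc_tuple.
Proof.
apply/freeP=> k sum0 i.
have /set0Pn[[x y] Ri] := scheme_rel_neq0 S i.
move/matrixP/(_ (enum_rank x) (enum_rank y)): sum0.
rewrite summxE (bigD1 i) //= big1 => [|j neq_ji].
  by rewrite assoc_nth !mxE !enum_rankK Ri mulr1 addr0.
rewrite assoc_nth !mxE !enum_rankK.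
by rewrite (disjointFl (scheme_rel_disjoint S neq_ji) Ri) mulr0.
Qed.

Lemma assoc_in i : assoc_mx i \in bose_mesner.
Proof. by rewrite -assoc_nth memv_span ?mem_nth ?size_tuple. Qed.

Hypothesis ordE : idempotent_ordering.

Let idem_in i : E i \in bose_mesner.
Proof.
by rewrite -idem_nth (basis_mem (idem_basis ordE)) ?mem_nth ?size_tuple.
Qed.

Lemma eigenmx1P j : assoc_mx j = \sum_i eigenmx1 i j *: E i.
Proof.
rewrite {1}(coord_basis (idem_basis ordE) (assoc_in j)).
by apply: eq_bigr => i _; rewrite mxE idem_nth.
Qed.

Lemma eigenmx2P j :
  E j = (#|X|%:R)^-1 *: \sum_i eigenmx2 i j *: assoc_mx i.
Proof.
apply: (canRL (scalerK cardX_neq0)).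
rewrite {1}(coord_span (memvZ #|X|%:R (idem_in j))).
by apply: eq_bigr => i _; rewrite mxE assoc_nth.
Qed.

Lemma hadamard_in A B :
  A \in bose_mesner -> B \in bose_mesner -> hadamard_mx A B \in bose_mesner.
Proof.
move=> /coord_span defA /coord_span defB; rewrite defA defB {defA defB}.
pose a i := coord assoc_tuple i A; pose b i := coord assoc_tuple i B.
have ->: hadamard_mx (\sum_i a i *: assoc_tuple`_i)
           (\sum_i b i *: assoc_tuple`_i) =
  \sum_i \sum_j (a i * b j) *: hadamard_mx (assoc_mx i) (assoc_mx j).
  apply/matrixP=> x y; rewrite mxE !summxE mulr_suml.
  apply: eq_bigr => i _; rewrite summxE mulr_sumr.
  by apply: eq_bigr => j _; rewrite !assoc_nth !mxE mulrACA.
apply: memv_suml => i _; apply: memv_suml => j _; apply: memvZ.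
by rewrite assoc_mx_hadamard; case: ifP; rewrite ?mem0v ?assoc_in.
Qed.

Lemma krein_numP i j :
  hadamard_mx (E i) (E j) = (#|X|%:R)^-1 *: \sum_h krein_num h i j *: E h.
Proof.
apply: (canRL (scalerK cardX_neq0)).
have /memvZ inM := hadamard_in (idem_in i) (idem_in j).
rewrite {1}(coord_basis (idem_basis ordE) (inM #|X|%:R)).
by apply: eq_bigr => h _; rewrite idem_nth.
Qed.

End Definitions.

(* Main.v *)
Require Import Defs.
From mathcomp Require Import all_boot all_order all_algebra.
From mathcomp Require Import reals complex.
From mathcomp Require Import ring.
Import GRing.Theory Num.Theory.
Local Open Scope ring_scope.

(** In the thin scheme of the group [F_2^2], whose relations are
    [R_g = {(x, y) | x + y = g}], index the idempotents by
    [E_h(x, y) = (-1)^(b(h, x + y)) / 4] for a nondegenerate bilinear form [b].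
    Both the products of the [A_g] and the Hadamard products of the [E_h] then
    follow the addition of labels, so [p = q] for every such [b].  On the other
    hand [P h g = (-1)^(b(h, g))] and [Q h g = (-1)^(b(g, h))], so that [P = Q]
    would force [b] to be symmetric; we take a form that is not. *)

Definition klein : finType := (bool * bool)%type.

Definition kadd (u v : klein) : klein := (u.1 (+) v.1, u.2 (+) v.2).

(** The bilinear form over F_2 with Gram matrix [[1, 1], [0, 1]]: unitriangular, hence
    nondegenerate, but not symmetric. *)
Definition kform (u v : klein) : bool :=
  (u.1 && (v.1 (+) v.2)) (+) (u.2 && v.2).

(** Binary digits, low bit first: [ord0] becomes the zero of the group, as R_0 and E_0 require. *)
Definition kvec (i : 'I_4) : klein := (odd i, 1 < i)%N.

Definition kidx (u : klein) : 'I_4 := inord (u.1 + u.2.*2).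

Lemma kvecK : cancel kvec kidx.
Proof.
by case=> [[|[|[|[|?]]]] //= lt_i4]; apply: val_inj; rewrite /= inordK.
Qed.

Lemma kidxK : cancel kidx kvec.
Proof. by rewrite /kidx /kvec => -[[] []]; rewrite inordK. Qed.

Lemma kvec_inj : injective kvec.
Proof. exact: can_inj kvecK. Qed.

Lemma kaddC : commutative kadd.
Proof. by move=> [[] []] [[] []]. Qed.

Lemma kadd_eq0 u v : (kadd u v == (false, false)) = (u == v).
Proof. by case: u v => [[] []] [[] []]. Qed.

Lemma kform_addl u v w : kform (kadd u v) w = kform u w (+) kform v w.
Proof. by case: u v w => [[] []] [[] []] [[] []]. Qed.

Lemma kform_addr u v w : kform u (kadd v w) = kform u v (+) kform u w.
Proof. by case: u v w => [[] []] [[] []] [[] []]. Qed.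

Lemma card_klein : #|klein| = 4.
Proof. by rewrite card_prod card_bool. Qed.

Definition klein_rel (i : 'I_4) : {set klein * klein} :=
  [set xy | kadd xy.1 xy.2 == kvec i].

Lemma klein_relE i x y : ((x, y) \in klein_rel i) = (kadd x y == kvec i).
Proof. by rewrite inE. Qed.

Definition klein_num (h i j : 'I_4) : int :=
  (kvec h == kadd (kvec i) (kvec j))%:R.

Lemma klein_rel_neq0 i : klein_rel i != set0.
Proof.
by apply/set0Pn; exists ((false, false), kvec i); rewrite klein_relE; case: kvec.
Qed.

Lemma klein_rel_cover : \bigcup_i klein_rel i = [set: klein * klein].
Proof.
apply/setP=> -[x y]; rewrite inE; apply/bigcupP.
by exists (kidx (kadd x y)); rewrite // klein_relE kidxK.
Qed.

Lemma klein_rel_disjoint i j : i != j -> [disjoint klein_rel i & klein_rel j].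
Proof.
move=> neq_ij; rewrite disjoints_subset; apply/subsetP=> -[x y].
by rewrite !inE => /eqP->; rewrite (inj_eq kvec_inj).
Qed.

Lemma klein_rel0 : klein_rel ord0 = [set xy | xy.1 == xy.2].
Proof. by apply/setP=> -[x y]; rewrite klein_relE inE kadd_eq0. Qed.

Lemma klein_rel_sym i x y : (x, y) \in klein_rel i -> (y, x) \in klein_rel i.
Proof. by rewrite !klein_relE kaddC. Qed.

Lemma klein_numP h i j x y : (x, y) \in klein_rel h ->
  klein_num h i j =
  #|[set z | ((x, z) \in klein_rel i) && ((z, y) \in klein_rel j)]|%:Z.
Proof.
rewrite klein_relE /klein_num => /eqP <-.
(* The condition x + z = i forces z = x + i, and then z + y = j amounts to x + y = i + j. *)
have -> : [set z | ((x, z) \in klein_rel i) && ((z, y) \in klein_rel j)] =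
    if kadd x y == kadd (kvec i) (kvec j) then [set kadd x (kvec i)] else set0.
  apply/setP=> z; rewrite inE !klein_relE.
  by case: x y z (kvec i) (kvec j) => [[] []] [[] []] [[] []] [[] []] [[] []];
    rewrite !inE.
by case: eqP; rewrite ?cards1 ?cards0.
Qed.

Lemma card_klein_gt0 : (0 < #|klein|)%N.
Proof. by rewrite card_klein. Qed.

Definition klein_scheme : sym_scheme 3 klein :=
  @SymScheme 3 klein klein_rel klein_num isT card_klein_gt0 klein_rel_neq0
    klein_rel_cover klein_rel_disjoint klein_rel0 klein_rel_sym klein_numP.

Section KleinIdempotents.
Variable R : realType.

Definition kchar (u v : klein) : R[i] := (-1) ^+ kform u v.

Lemma kchar_addl u v w : kchar (kadd u v) w = kchar u w * kchar v w.
Proof. by rewrite /kchar kform_addl signr_addb. Qed.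

Lemma kchar_addr u v w : kchar u (kadd v w) = kchar u v * kchar u w.
Proof. by rewrite /kchar kform_addr signr_addb. Qed.

Lemma sum_klein (F : klein -> R[i]) :
  \sum_u F u = F (true, true) + F (true, false)
             + (F (false, true) + F (false, false)).
Proof.
rewrite (eq_bigr (fun u => F (u.1, u.2))); last by case.
by rewrite -(pair_bigA _ (fun a b => F (a, b))) /= !big_bool.
Qed.

(** For v nonzero, u |-> b(u, v) is a nonzero linear form by nondegeneracy, so the signs cancel.
    Since b is not symmetric, [sum_kcharr] is a separate fact about the other argument. *)
Lemma sum_kcharl v : \sum_u kchar u v = #|klein|%:R *+ (v == (false, false)).
Proof.
by rewrite card_klein sum_klein /kchar; case: v => [[] []] /=;
  rewrite ?mulr0n ?mulr1n /=; ring.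
Qed.

Lemma sum_kcharr u : \sum_v kchar u v = #|klein|%:R *+ (u == (false, false)).
Proof.
by rewrite card_klein sum_klein /kchar; case: u => [[] []] /=;
  rewrite ?mulr0n ?mulr1n /=; ring.
Qed.

Lemma sum_enum_klein (F : klein -> R[i]) :
  \sum_(a < #|klein|) F (enum_val a) = \sum_u F u.
Proof. by rewrite -big_enum_val. Qed.

Lemma sum_kvec (V : nmodType) (F : klein -> V) : \sum_i F (kvec i) = \sum_u F u.
Proof.
by rewrite [RHS](reindex kvec) //; exists kidx => ? _; rewrite (kvecK, kidxK).
Qed.

Let cardK : #|klein|%:R != 0 :> R[i].
Proof. by rewrite card_klein pnatr_eq0. Qed.

Definition klein_idem (i : 'I_4) : 'M[R[i]]_#|klein| :=
  \matrix_(a, b)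
    (#|klein|%:R^-1 * kchar (kvec i) (kadd (enum_val a) (enum_val b))).

Local Notation S := klein_scheme.
Local Notation E := klein_idem.

(** Fourier inversion: at a position with x = a + b, the right side averages the signs of b(u, x +
    j) over u, which gives 0 unless x = j. *)
Lemma klein_assoc_expand j :
  assoc_mx R S j = \sum_i kchar (kvec i) (kvec j) *: E i.
Proof.
apply/matrixP=> a b; rewrite summxE mxE klein_relE.
set x := kadd _ _.
under eq_bigr => i _ do rewrite !mxE -/x mulrCA -kchar_addr.
rewrite -mulr_sumr (sum_kvec _ (fun u => kchar u _)) sum_kcharl kadd_eq0 eq_sym.
by case: eqP; rewrite ?mulr0 ?mulVf.
Qed.

(** Only the relation containing the position contributes. Compared with [klein_assoc_expand], the
    arguments of [kchar] are exchanged, which makes Q the transpose of P. *)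
Lemma klein_idem_expand j :
  #|klein|%:R *: E j = \sum_i kchar (kvec j) (kvec i) *: assoc_mx R S i.
Proof.
apply/matrixP=> a b; rewrite summxE !mxE mulVKf //.
under eq_bigr => i _ do rewrite !mxE klein_relE.
rewrite (sum_kvec _ (fun u => kchar _ u * (_ == u)%:R)).
set x := kadd _ _.
rewrite (bigD1 x) //= eqxx mulr1 big1 ?addr0 // => u /negPf.
by rewrite eq_sym => ->; rewrite mulr0.
Qed.

Lemma klein_idem_mul i j : E i *m E j = if i == j then E i else 0.
Proof.
apply/matrixP=> a b; rewrite mxE.
set x := enum_val a; set y := enum_val b.
pose n : R[i] := #|klein|%:R.
(* Bilinearity isolates the dependence on the summation index u as the character of label i + j,
   whose sum vanishes unless i = j. *)
have -> : \sum_c E i a c * E j c b =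
    \sum_u n^-1 * n^-1 * (kchar (kvec i) x * kchar (kvec j) y) *
      kchar (kadd (kvec i) (kvec j)) u.
  rewrite -sum_enum_klein; apply: eq_bigr => c _; rewrite !mxE -/x -/y -/n.
  by rewrite !kchar_addr kchar_addl; ring.
rewrite -mulr_sumr sum_kcharr kadd_eq0 (inj_eq kvec_inj).
case: eqVneq => [->|_]; rewrite ?mulr0 mxE // -kchar_addr -/n mulr1n.
by field.
Qed.

(** Additivity of the form on the left: characters multiply pointwise as their labels add. The Krein
    parameters thus follow the same rule as [klein_num]. *)
Lemma klein_hadamard i j :
  #|klein|%:R *: hadamard_mx (E i) (E j) = E (kidx (kadd (kvec i) (kvec j))).
Proof.
apply/matrixP=> a b; rewrite !mxE kidxK kchar_addl.
by rewrite [X in _ * X]mulrACA -!mulrA mulVKf.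
Qed.

Lemma klein_idem_tuple (i : 'I_4) : (idem_tuple E)`_i = E i.
Proof. by rewrite -tnth_nth tnth_mktuple. Qed.

Lemma klein_assoc_tuple (i : 'I_4) : (assoc_tuple R S)`_i = assoc_mx R S i.
Proof. by rewrite -tnth_nth tnth_mktuple. Qed.

(** The four idempotents span by [klein_assoc_expand], and the dimension is four by [assoc_free]. *)
Lemma klein_idem_basis : basis_of (bose_mesner R S) (idem_tuple E).
Proof.
rewrite basisEdim size_tuple; apply/andP; split; last first.
  by have /eqP-> := assoc_free R S; rewrite size_tuple.
apply/span_subvP=> _ /tnthP[j ->]; rewrite tnth_mktuple klein_assoc_expand.
apply: memv_suml => i _; apply/memvZ/memv_span.
by rewrite -klein_idem_tuple mem_nth ?size_tuple.
Qed.

Lemma klein_idem_ordering : idempotent_ordering S E.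
Proof.
split; [exact: klein_idem_basis | | exact: klein_idem_mul |].
- apply/matrixP=> a b; rewrite summxE.
  under eq_bigr => i _ do rewrite mxE.
  rewrite -mulr_sumr (sum_kvec _ (fun u => kchar u _)) sum_kcharl kadd_eq0.
  rewrite (inj_eq enum_val_inj) mxE.
  by case: eqP; rewrite ?mulr0 ?mulVf.
(* The label [ord0] is the zero vector, so its character computes to 1 everywhere. *)
- by apply/matrixP=> a b; rewrite !mxE.
Qed.

Lemma klein_numerically_self_dual : numerically_self_dual S E.
Proof.
move=> h i j; rewrite /krein_num klein_hadamard -klein_idem_tuple.
rewrite coord_free ?(basis_free klein_idem_basis) //= /klein_num.
by rewrite (can2_eq kvecK kidxK) rmorph_nat eq_sym.
Qed.

Lemma klein_eigenmx1 i j : eigenmx1 S E i j = kchar (kvec i) (kvec j).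
Proof.
rewrite mxE klein_assoc_expand.
under eq_bigr => k _ do rewrite -klein_idem_tuple.
by rewrite coord_sum_free ?(basis_free klein_idem_basis).
Qed.

Lemma klein_eigenmx2 i j : eigenmx2 S E i j = kchar (kvec j) (kvec i).
Proof.
rewrite mxE klein_idem_expand.
under eq_bigr => k _ do rewrite -klein_assoc_tuple.
by rewrite coord_sum_free ?assoc_free.
Qed.

Lemma klein_not_formally_self_dual : ~ formally_self_dual S E.
Proof.
(* The two basis vectors witness the asymmetry: b(e1, e2) = 1 and b(e2, e1) = 0, so the entry is -1
   in P and 1 in Q. *)
move/matrixP/(_ (kidx (true, false)) (kidx (false, true))).
rewrite klein_eigenmx1 klein_eigenmx2 !kidxK /kchar /= expr0 expr1.
by move/eqP; rewrite -subr_eq0 -opprD oppr_eq0 -mulr2n pnatr_eq0.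
Qed.

End KleinIdempotents.

Theorem mainTheorem1 (R : realType) :
  exists (d : nat) (X : finType) (S : sym_scheme d X)
         (E : 'I_d.+1 -> 'M[R[i]]_#|X|),
    [/\ idempotent_ordering S E,
        numerically_self_dual S E
      & ~ formally_self_dual S E].
Proof.
exists 3, klein, klein_scheme, (klein_idem R); split.
- exact: klein_idem_ordering.
- exact: klein_numerically_self_dual.
- exact: klein_not_formally_self_dual.
Qed.
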